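(* The relation $\preceq$ induces a total order on the set of geometric random variables; precisely, for all $p_1,p_2\in(0,1)$, $$\mathrm{Geom}(p_1)\preceq \mathrm{Geom}(p_2)\quad\text{if and only if}\quad p_1\le p_2 .$$
   Context: All random variables take values in $\mathbb{Z}_+=\{0,1,2,\dots\}$. For $p\in(0,1)$, $\mathrm{Geom}(p)$ denotes a random variable with mass function $i\mapsto(1-p)p^i$, $i\in\mathbb{Z}_+$. A random variable $X$ with mass function $p_X(i)=\mathbb{P}(X=i)$ is log-concave if $p_X(i)^2\ge p_X(i-1)p_X(i+1)$ for all $i\ge1$. For each random variable $V$, define $\mathcal{C}_V=\{W \text{ independent of } V:\ V+W \text{ is log-concave}\}$; membership of $W$ depends only on the distributions of $V$ and $W$, so $\mathcal{C}_V$ is regarded as a set of distributions on $\mathbb{Z}_+$ (those $W$ for which the sum of independent copies of $V$ and $W$ is log-concave). Write $V_1\preceq V_2$ if and only if $\mathcal{C}_{V_1}\subseteq\mathcal{C}_{V_2}$. *)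

(* Defs.v *)
From HB Require Import structures.
From mathcomp Require Import all_boot all_order all_algebra.
From mathcomp Require Import all_classical all_reals all_analysis.

Set Implicit Arguments.
Unset Strict Implicit.
Unset Printing Implicit Defensive.

Import Order.TTheory GRing.Theory Num.Theory.
Import numFieldNormedType.Exports.

Local Open Scope classical_set_scope.
Local Open Scope ring_scope.

Section nat_random_variables.
Context d (T : measurableType d) (R : realType) (P : probability T R).

Definition mass (X : {RV P >-> nat}) (i : nat) : R := fine (P (X @^-1` [set i])).

(* No condition on the support is imposed: internal zeros are not excluded. *)
Definition log_concave (X : {RV P >-> nat}) : Prop :=
  forall i, (1 <= i)%N -> mass X i.-1 * mass X i.+1 <= mass X i ^+ 2.

Definition independent (V W : {RV P >-> nat}) : Prop :=
  forall A B : set nat, measurable A -> measurable B ->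
    P (V @^-1` A `&` W @^-1` B) = (P (V @^-1` A) * P (W @^-1` B))%E.

Definition has_law (X : {RV P >-> nat}) (mu : probability nat R) : Prop :=
  forall A, measurable A -> distribution P X A = mu A.

Definition rv_add (V W : {RV P >-> nat}) : T -> nat := fun w => (V w + W w)%N.

Lemma measurable_rv_add (V W : {RV P >-> nat}) :
  measurable_fun [set: T] (rv_add V W).
Proof. exact: measurable_realfun.measurable_fun_addn. Qed.

HB.instance Definition _ (V W : {RV P >-> nat}) :=
  isMeasurableFun.Build _ _ _ _ (rv_add V W) (measurable_rv_add V W).

End nat_random_variables.
Arguments mass {d T R} P X i.
Arguments log_concave {d T R} P X.
Arguments independent {d T R} P V W.
Arguments has_law {d T R} P X mu.
Arguments rv_add {d T R} P V W.

(* The class C_V depends on V only through its law mu.  Quantifying over all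
   realisations of the pair (mu, nu) by independent variables is not vacuous,
   see independent_copies_exist. *)
Definition calC (R : realType) (mu : probability nat R) :
    set (probability nat R) :=
  [set nu | forall d (T : measurableType d) (P : probability T R)
              (V W : {RV P >-> nat}),
     has_law P V mu -> has_law P W nu -> independent P V W ->
     log_concave P (rv_add P V W)].

Definition preceq (R : realType) (mu1 mu2 : probability nat R) : Prop :=
  calC mu1 `<=` calC mu2.

Lemma independent_copies_exist (R : realType) (mu nu : probability nat R) :
  exists d (T : measurableType d) (P : probability T R)
    (V W : {RV P >-> nat}),
    [/\ has_law P V mu, has_law P W nu & independent P V W].
Proof.
pose P : probability (nat * nat)%type R := (mu \x nu)%E.
pose V : {RV P >-> nat} := mfun_Sub (mem_set (@measurable_fst _ _ nat nat)).
pose W : {RV P >-> nat} := mfun_Sub (mem_set (@measurable_snd _ _ nat nat)).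
have VE A : V @^-1` A = A `*` [set: nat].
  by apply/seteqP; split => -[x y] //= [].
have WE A : W @^-1` A = [set: nat] `*` A.
  by apply/seteqP; split => -[x y] //= [].
have PV A : measurable A -> P (V @^-1` A) = mu A.
  move=> mA; rewrite VE /P /= product_measure1E//.
  by rewrite [X in (_ * X)%E](_ : _ = 1%E) ?mule1//; exact: probability_setT.
have PW A : measurable A -> P (W @^-1` A) = nu A.
  move=> mA; rewrite WE /P /= product_measure1E//.
  by rewrite [X in (X * _)%E](_ : _ = 1%E) ?mul1e//; exact: probability_setT.
exists _, _, P, V, W; split => // A B mA mB.
rewrite PV// PW// (_ : _ `&` _ = A `*` B).
  by rewrite /P /= product_measure1E.
by apply/seteqP; split => -[x y].
Qed.

Definition geometric_pmf (R : realType) (p : R) (i : nat) : R :=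
  (1 - p) * p ^+ i.

(* Outside 0 < p < 1 the value is a junk Dirac mass. *)
Definition geometric_prob (R : realType) (p : R) : set nat -> \bar R :=
  fun U => if 0 < p < 1 then (\esum_(i in U) (geometric_pmf p i)%:E)%E
           else \d_0%N U.

Section geometric_prob.
Context (R : realType) (p : R).
Local Open Scope ereal_scope.

Let pmf_ge0 i : (0 < p < 1)%R -> 0 <= (geometric_pmf p i)%:E.
Proof.
by case/andP=> p0 p1; rewrite lee_fin mulr_ge0 ?exprn_ge0 ?subr_ge0 ?ltW.
Qed.

Let geometric0 : geometric_prob p set0 = 0.
Proof. by rewrite /geometric_prob measure0; case: ifPn => //; rewrite esum_set0. Qed.

Let geometric_ge0 U : 0 <= geometric_prob p U.
Proof.
rewrite /geometric_prob; case: ifPn => // p01.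
by apply: esum_ge0 => i _; exact: pmf_ge0.
Qed.

Let geometric_sigma_additive : semi_sigma_additive (geometric_prob p).
Proof.
move=> F mF tF mUF; rewrite /geometric_prob; case: ifPn => p01; last first.
  exact: measure_semi_sigma_additive.
apply: cvg_toP.
  apply: ereal_nondecreasing_is_cvgn => a b ab.
  apply: lee_sum_nneg_natr => // n _ _.
  by apply: esum_ge0 => i _; exact: pmf_ge0.
by rewrite nneseries_sum_bigcup// => i; exact: pmf_ge0.
Qed.

HB.instance Definition _ := isMeasure.Build _ _ _ (geometric_prob p)
  geometric0 geometric_ge0 geometric_sigma_additive.

Let geometric_setT : geometric_prob p [set: nat] = 1.
Proof.
rewrite /geometric_prob; case: ifPn => [p01|_]; last by rewrite probability_setT.
rewrite -nneseries_esumT; last by move=> i; exact: pmf_ge0.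
have [p0 p1] := andP p01.
apply/cvg_lim => //.
rewrite (_ : (fun n => _) = EFin \o series (geometric (1 - p)%R p)); last first.
  by apply/funext => n /=; rewrite /series /= -sumEFin.
apply: cvg_EFin; first exact: nearW.
have := @cvg_geometric_series R (1 - p)%R p.
rewrite divff ?subr_eq0 ?gt_eqF//; apply.
by rewrite ger0_norm// ltW.
Qed.

HB.instance Definition _ :=
  @Measure_isProbability.Build _ _ R (geometric_prob p) geometric_setT.

End geometric_prob.

Definition geometric_law (R : realType) (p : R) : probability nat R :=
  geometric_prob p.

Definition geometric_laws (R : realType) : set (probability nat R) :=
  [set geometric_law p | p in [set p : R | 0 < p < 1]].

Definition total_order_on (T : Type) (A : set T) (r : T -> T -> Prop) : Prop :=
  [/\ forall x, A x -> r x x,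
      forall x y, A x -> A y -> r x y -> r y x -> x = y,
      forall x y z, A x -> A y -> A z -> r x y -> r y z -> r x z &
      forall x y, A x -> A y -> r x y \/ r y x].

(* Main.v *)
From HB Require Import structures.
Require Import Defs.
From mathcomp Require Import all_boot all_order all_algebra.
From mathcomp Require Import all_classical all_reals all_analysis.
From mathcomp Require Import ring lra.
Import Order.TTheory GRing.Theory Num.Theory.
Local Open Scope ring_scope.

(** Let w be the mass function of W and let u_n = sum_(k <= n) w_k p^(n-k), so
    that Geom(p) + W has mass function (1-p) u.  From u_(n+1) = p u_n + w_(n+1)
    one gets

      u_(n+1)^2 - u_n u_(n+2) = u_(n+1) w_(n+1) - u_n w_(n+2),

    so log-concavity of Geom(p) + W says that each ratio u_(n+1)/u_n dominates
    w_(n+2)/w_(n+1) ([log_concave_geom_convE]).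

    If p <= q, the convolution v of w with the powers of q is u + (q-p) t, where
    t is the convolution of u itself with the powers of q, delayed by one step
    ([geom_conv_change_ratio]).  As u is log-concave, its ratios decrease, and
    t_(n+1)/t_n, which is at least an average of the ratios u_(k+1)/u_k with
    k < n, dominates u_(n+1)/u_n; hence it dominates w_(n+2)/w_(n+1), and so does
    v_(n+1)/v_n.
    This is the monotonicity [log_concave_geom_conv_le].

    If q < p, a three-point law separates the two classes: with weights
    proportional to (1, 1, 1+p), log-concavity of the convolution for the ratio
    r holds exactly when p <= r ([log_concave_extremal_weight]), so this law
    belongs to the class of Geom(p) and not to that of Geom(q).

    The total order is then inherited from the order of the parameters. *)

(** * Convolution with a geometric sequence *)

Section geom_conv.
Context {R : realFieldType}.
Implicit Types (p q : R) (w u a : nat -> R).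

Definition log_concave_seq a : Prop :=
  forall n, a n * a n.+2 <= a n.+1 ^+ 2.

Definition geom_conv p w (n : nat) : R := \sum_(k < n.+1) w k * p ^+ (n - k).

Lemma geom_conv0 p w : geom_conv p w 0 = w 0%N.
Proof. by rewrite /geom_conv big_ord1 subnn expr0 mulr1. Qed.

Lemma geom_convS p w n : geom_conv p w n.+1 = p * geom_conv p w n + w n.+1.
Proof.
rewrite /geom_conv big_ord_recr /= subnn expr0 mulr1 mulr_sumr; congr (_ + _).
apply: eq_bigr => k _; rewrite subSn; last by rewrite -ltnS.
by rewrite exprS mulrCA.
Qed.

Lemma geom_conv_ge0 p w n : 0 <= p -> (forall k, 0 <= w k) ->
  0 <= geom_conv p w n.
Proof. by move=> p0 w0; apply: sumr_ge0 => k _; rewrite mulr_ge0 ?exprn_ge0. Qed.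

(** Substituting the recurrence for [geom_conv p w n.+2] and for one of the two
    factors [geom_conv p w n.+1] makes the terms in [p] cancel.  The ratio [p]
    survives only inside the convolution, which makes different ratios
    comparable. *)
Lemma log_concave_geom_convE p w :
  log_concave_seq (geom_conv p w) <->
  forall n, geom_conv p w n * w n.+2 <= geom_conv p w n.+1 * w n.+1.
Proof.
have lcE n : (geom_conv p w n * geom_conv p w n.+2 <= geom_conv p w n.+1 ^+ 2) =
    (geom_conv p w n * w n.+2 <= geom_conv p w n.+1 * w n.+1).
  rewrite -subr_ge0 -[RHS]subr_ge0; congr (0 <= _).
  by rewrite (geom_convS p w n.+1) (geom_convS p w n); ring.
by split=> h n; have := h n; rewrite lcE.
Qed.

(** Changing the ratio from [p] to [q] adds [q - p] times the convolution
    against the larger ratio, delayed by one step: this is the generating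
    function identity 1/(1-qz) = (1/(1-pz)) (1 + (q-p) z/(1-qz)). *)
Definition delayed_conv q u (n : nat) : R :=
  if n is m.+1 then geom_conv q u m else 0.

Lemma delayed_convS q u n :
  delayed_conv q u n.+1 = q * delayed_conv q u n + u n.
Proof. by case: n => [|n] /=; rewrite ?geom_conv0 ?mulr0 ?add0r// geom_convS. Qed.

Lemma geom_conv_change_ratio p q w n :
  geom_conv q w n =
  geom_conv p w n + (q - p) * delayed_conv q (geom_conv p w) n.
Proof.
elim: n => [|n IHn]; first by rewrite !geom_conv0 /= mulr0 addr0.
by rewrite delayed_convS !geom_convS IHn; ring.
Qed.

(** The ratio inequalities x/y <= d/c <= b/a compose even when a denominator
    vanishes, provided that c = 0 forces a = 0. *)
Lemma cross_ratio_trans (a b c d x y : R) :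
  0 <= a -> 0 <= b -> 0 <= c -> 0 <= y -> (c = 0 -> a = 0) ->
  a * d <= b * c -> c * x <= d * y -> a * x <= b * y.
Proof.
move=> a0 b0 c0 y0 ca ad cx.
have [/ca->|cN0] := eqVneq c 0; first by rewrite mul0r mulr_ge0.
have {cN0}c_gt0 : 0 < c by rewrite lt_def cN0.
rewrite -(ler_pM2l c_gt0).
have := ler_wpM2l a0 cx; have := ler_wpM2r y0 ad; lra.
Qed.

Section monotonicity.
Context (p q : R) (w : nat -> R).
Hypotheses (p_gt0 : 0 < p) (le_pq : p <= q) (w_ge0 : forall k, 0 <= w k).
Hypothesis lc_p : log_concave_seq (geom_conv p w).

Let u := geom_conv p w.
Let t := delayed_conv q u.

Let tS n : t n.+1 = q * t n + u n.
Proof. exact: delayed_convS. Qed.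

Let u_ge0 n : 0 <= u n.
Proof. by apply: geom_conv_ge0 => //; exact: ltW. Qed.

Let t_ge0 n : 0 <= t n.
Proof.
case: n => [|n] //=; apply: geom_conv_ge0 => //.
exact: le_trans (ltW p_gt0) le_pq.
Qed.

(* As [p] is positive, [u] stays positive once it is; so [u n = 0] forces [u] to
   vanish on all of [0, n], and [t n] only involves these values.  In particular
   [u] has no internal zeros, even if [w] has some. *)
Let t_eq0 n : u n = 0 -> t n = 0.
Proof.
elim: n => [//|n IHn] /eqP.
rewrite /u geom_convS (paddr_eq0 (mulr_ge0 (ltW p_gt0) (u_ge0 n)) (w_ge0 _)).
rewrite mulf_eq0 (gt_eqF p_gt0) orFb.
by move=> /andP[/eqP un0 _]; rewrite tS IHn// mulr0 add0r.
Qed.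

(* The recurrence makes t_(n+2)/t_(n+1) the mediant of (q t_(n+1))/(q t_n) and
   u_(n+1)/u_n.  By induction the first is at least the second, and the second is
   at least u_(n+2)/u_(n+1) by log-concavity of [u]. *)
Let t_ratio n : t n * u n.+1 <= t n.+1 * u n.
Proof.
elim: n => [|n IHn]; first by rewrite [t 0](_ : _ = 0)// mul0r mulr_ge0.
have tu : t n * u n.+2 <= t n.+1 * u n.+1.
  apply: (cross_ratio_trans _ _ (u n) (u n.+1)) => //; exact: t_eq0.
rewrite (tS n.+1) {1}(tS n).
have q_ge0 : 0 <= q by exact: le_trans (ltW p_gt0) le_pq.
have := ler_wpM2l q_ge0 tu; have := lc_p n; rewrite -/u expr2.
lra.
Qed.

(** With u the convolution for [p], log-concavity for [p] says that
    w_(n+2)/w_(n+1) <= u_(n+1)/u_n.  The same bound then holds with u replaced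
    by the delayed convolution, hence by the convolution for [q], which is a
    nonnegative combination of the two. *)
Lemma log_concave_geom_conv_le : log_concave_seq (geom_conv q w).
Proof.
apply/log_concave_geom_convE => n.
have uw : u n * w n.+2 <= u n.+1 * w n.+1.
  by move/log_concave_geom_convE : lc_p; apply.
have tw : t n * w n.+2 <= t n.+1 * w n.+1.
  by apply: (cross_ratio_trans _ _ (u n) (u n.+1)) => //; exact: t_eq0.
rewrite !(geom_conv_change_ratio p q) -/u -/t.
have qp_ge0 : 0 <= q - p by rewrite subr_ge0.
have := ler_wpM2l qp_ge0 tw; lra.
Qed.

End monotonicity.

(** A sequence with three terms gives the single nontrivial inequality
    w_0 w_2 <= (q w_0 + w_1) w_1 for its convolution with ratio [q].  The weights
    (1, 1, 1 + p) turn it into an equality at q = p; dividing by 3 + p makes them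
    a probability. *)
Definition extremal_weight p (k : nat) : R :=
  nth 0 [:: (3 + p)^-1; (3 + p)^-1; (1 + p) / (3 + p)] k.

Lemma extremal_weight_ge0 p k : 0 <= p -> 0 <= extremal_weight p k.
Proof.
move=> p0; have c0 : 0 <= (3 + p)^-1 by rewrite invr_ge0 addr_ge0.
by case: k => [|[|[|[|k]]]] //=; rewrite /extremal_weight /= mulr_ge0// addr_ge0.
Qed.

Lemma sum_extremal_weight p : 0 <= p -> \sum_(k < 3) extremal_weight p k = 1.
Proof.
move=> p0; rewrite !big_ord_recl big_ord0 /extremal_weight /=.
by field; apply: lt0r_neq0; lra.
Qed.

Lemma log_concave_extremal_weight p q : 0 <= p -> 0 <= q ->
  log_concave_seq (geom_conv q (extremal_weight p)) <-> p <= q.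
Proof.
move=> p0 q0; have c0 : 0 < (3 + p)^-1 by rewrite invr_gt0; lra.
have low : geom_conv q (extremal_weight p) 0 * extremal_weight p 2 <=
           geom_conv q (extremal_weight p) 1 * extremal_weight p 1 <-> p <= q.
  rewrite geom_convS geom_conv0 /extremal_weight /=.
  rewrite mulrC -subr_ge0 -[p <= q]subr_ge0.
  rewrite [X in 0 <= X](_ : _ = (3 + p)^-1 ^+ 2 * (q - p)); last by ring.
  by rewrite pmulr_rge0// exprn_gt0.
split=> [/log_concave_geom_convE/(_ 0%N)/low//|/low pq].
apply/log_concave_geom_convE => -[//|n].
rewrite [extremal_weight p n.+3]nth_default ?mulr0//.
apply: mulr_ge0; last exact: extremal_weight_ge0.
by apply: geom_conv_ge0 => // k; exact: extremal_weight_ge0.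
Qed.

End geom_conv.

(** * Laws on the natural numbers *)

Section laws.
Local Open Scope classical_set_scope.
Local Open Scope ring_scope.
Context {R : realType}.
Implicit Types (p q : R) (mu nu : probability nat R).

Lemma exists_law_of_weights (w : nat -> R) m :
  (forall k, 0 <= w k) -> \sum_(k < m) w k = 1 ->
  exists nu : probability nat R,
    forall i, fine (nu [set i]) = if (i < m)%N then w i else 0.
Proof.
move=> w_ge0 w1.
pose mix : {measure set nat -> \bar R} :=
  msum (fun k => mscale (NngNum (w_ge0 k)) (\d_k : measure nat R)) m.
have mixE A : mix A = (\sum_(k < m) w k * \1_A (k : nat))%:E.
  rewrite /mix /msum /= -sumEFin; apply: eq_bigr => k _.
  by rewrite [LHS](_ : _ = ((w k)%:E * \d_(k : nat) A)%E)// diracE indicE EFinM.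
have mixT : mix setT = 1%E.
  by rewrite mixE; under eq_bigr do rewrite indicT mulr1; rewrite w1.
pose nu : probability nat R :=
  HB.pack (Measure.sort mix) (Measure_isProbability.Build _ _ R mix mixT).
exists nu => i.
rewrite [nu _]mixE /=; case: ifPn => [im|].
  rewrite (bigD1 (Ordinal im))//= big1 ?addr0; last first.
    move=> k /eqP ki; rewrite indicE memNset ?mulr0//= => /esym ik.
    by apply: ki; apply: val_inj.
  by rewrite indicE mem_set// mulr1.
rewrite -leqNgt => mi; apply: big1 => k _.
rewrite indicE memNset ?mulr0//= => ki.
by move: (ltn_ord k); rewrite ki ltnNge mi.
Qed.

Lemma geometric_law1 p i : 0 < p < 1 ->
  geometric_law p [set i] = ((1 - p) * p ^+ i)%:E.
Proof.
move=> p01; rewrite /geometric_law /= /geometric_prob p01 esum_set1//.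
by case/andP: p01 => p0 p1; rewrite lee_fin mulr_ge0 ?exprn_ge0 ?subr_ge0 ?ltW.
Qed.

Lemma mass_rv_add d (T : measurableType d) (P : probability T R)
    (V W : {RV P >-> nat}) n : independent P V W ->
  mass P (rv_add P V W) n = \sum_(k < n.+1) mass P W k * mass P V (n - k).
Proof.
move=> VW.
pose F k := V @^-1` [set n - k]%N `&` W @^-1` [set k].
have mX (X : {RV P >-> nat}) (A : set nat) : measurable (X @^-1` A).
  by rewrite -[X @^-1` A]setTI; exact: measurable_funP.
have FE : rv_add P V W @^-1` [set n] = \big[setU/set0]_(k < n.+1) F k.
  rewrite -bigcup_mkord; apply/seteqP; split => x /=.
    rewrite /rv_add => VWn; exists (W x) => /=; first by rewrite ltnS -VWn leq_addl.
    by split=> //=; rewrite -VWn addnK.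
  by move=> [k /= kn [/= Vx Wx]]; rewrite /rv_add Vx Wx subnK// -ltnS.
rewrite /mass FE measure_bigsetU; first last.
- apply/trivIsetP => i j _ _ /eqP ij; apply/seteqP; split=> x //= [[_ Wi] [_ Wj]].
  by apply: ij; rewrite -[i]Wi -[j]Wj.
- by move=> k; apply: measurableI.
rewrite -sum_fine; last by move=> k _; exact: fin_num_measure (measurableI _ _ _ _).
apply: eq_bigr => k _; rewrite [X in fine X](VW [set n - k]%N [set nat_of_ord k])//.
rewrite fineM; first by rewrite mulrC.
- exact: fin_num_measure.
- exact: fin_num_measure.
Qed.

Lemma mass_has_law d (T : measurableType d) (P : probability T R)
    (X : {RV P >-> nat}) mu i : has_law P X mu -> mass P X i = fine (mu [set i]).
Proof. by move=> Xmu; rewrite -Xmu. Qed.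

(** The mass function of a sum of independent variables is fixed by the two laws,
    so one realisation of the pair decides for all of them; the normalising
    factor [1 - p] drops out because log-concavity is homogeneous. *)
Lemma calC_geometricE p nu : 0 < p < 1 ->
  calC (geometric_law p) nu <->
  log_concave_seq (geom_conv p (fun k => fine (nu [set k]))).
Proof.
move=> p01; have q0 : 0 < (1 - p) ^+ 2.
  by rewrite exprn_gt0// subr_gt0; case/andP: p01.
have massE d (T : measurableType d) (P : probability T R)
    (V W : {RV P >-> nat}) n :
    has_law P V (geometric_law p) -> has_law P W nu -> independent P V W ->
    mass P (rv_add P V W) n =
    (1 - p) * geom_conv p (fun k => fine (nu [set k])) n.
  move=> Vp Wnu VW; rewrite mass_rv_add// /geom_conv mulr_sumr.
  apply: eq_bigr => k _.
  rewrite (mass_has_law _ _ _ _ _ _ Vp) (mass_has_law _ _ _ _ _ _ Wnu).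
  by rewrite geometric_law1//= mulrCA.
split=> [nuC n|lc d T P V W Vp Wnu VW [//|n] _] /=.
  have [d [T [P [V [W [Vp Wnu VW]]]]]] :=
    independent_copies_exist (geometric_law p) nu.
  have /= := nuC _ _ _ _ _ Vp Wnu VW n.+1 isT.
  by rewrite !(massE _ _ _ _ _ _ Vp Wnu VW) exprMn mulrACA -expr2 ler_pM2l.
by rewrite !(massE _ _ _ _ _ _ Vp Wnu VW) exprMn mulrACA -expr2 ler_pM2l.
Qed.

Lemma preceq_geometricE p1 p2 : 0 < p1 < 1 -> 0 < p2 < 1 ->
  preceq (geometric_law p1) (geometric_law p2) <-> p1 <= p2.
Proof.
move=> p1_01 p2_01.
have [[p1_gt0 _] [p2_gt0 _]] := (andP p1_01, andP p2_01).
split=> [le_C|le_p nu]; last first.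
  move=> /(calC_geometricE _ _ p1_01) lc1.
  apply/(calC_geometricE _ _ p2_01)/(log_concave_geom_conv_le p1) => // k.
  exact/fine_ge0.
have [nu nuE] := exists_law_of_weights (extremal_weight p1) 3
  (fun k => extremal_weight_ge0 p1 k (ltW p1_gt0))
  (sum_extremal_weight p1 (ltW p1_gt0)).
have {}nuE : (fun k => fine (nu [set k])) = extremal_weight p1.
  apply/funext => k; rewrite nuE; case: ltnP => // k3.
  by rewrite /extremal_weight nth_default.
have nuC q : 0 < q < 1 -> calC (geometric_law q) nu <-> p1 <= q.
  move=> q01; have [q_gt0 _] := andP q01.
  rewrite -(log_concave_extremal_weight p1 q (ltW p1_gt0) (ltW q_gt0)) -nuE.
  exact: calC_geometricE.
by apply/(nuC _ p2_01)/le_C/(nuC _ p1_01).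
Qed.

End laws.

Theorem theorem4p4 (R : realType) :
  total_order_on (@geometric_laws R) (@preceq R) /\
  (forall p1 p2 : R, 0 < p1 < 1 -> 0 < p2 < 1 ->
     (preceq (geometric_law p1) (geometric_law p2) <-> p1 <= p2)).
Proof.
split; last exact: preceq_geometricE.
split=> [x _|_ _ [p p01 <-] [q q01 <-]|x y z _ _ _|_ _ [p p01 <-] [q q01 <-]].
- exact: subset_refl.
- move=> /preceq_geometricE-/(_ p01 q01) pq /preceq_geometricE-/(_ q01 p01) qp.
  by congr geometric_law; apply/eqP; rewrite eq_le pq qp.
- exact: subset_trans.
- by rewrite !preceq_geometricE//; apply/orP/le_total.
Qed.
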